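(* Let $C$ be an orientation of a cycle of even length $\ell$. If $t(C,1/2+U_T)\le 2^{-\ell}$ and $\gamma_C=1$, then $C$ is not quasirandom-forcing. Similarly, if $t(C,1/2+U_T)\ge 2^{-\ell}$ and $\gamma_C=-1$, then $C$ is not quasirandom-forcing.
   Context: A kernel is a bounded measurable function $[0,1]^2\to\mathbb{R}$. A tournamenton is a non-negative kernel $W$ with $W(x,y)+W(y,x)=1$ for all $(x,y)$. For an oriented graph $H$ and a kernel $U$, $t(H,U)=\int_{[0,1]^{V(H)}}\prod_{vw\in E(H)}U(x_v,x_w)\,\mathrm{d}x_{V(H)}$; $\|H\|$ is the number of edges of $H$. $H$ is quasirandom-forcing if every tournamenton $W$ with $t(H,W)=2^{-\|H\|}$ equals $1/2$ almost everywhere. $U_T$ is the kernel with $U_T(x,y)=1/2$ if $0\le x<y\le 1$, $U_T(x,y)=-1/2$ if $0\le y<x\le 1$, and $U_T(x,y)=0$ otherwise; $1/2+U_T$ is the tournamenton $(x,y)\mapsto 1/2+U_T(x,y)$. For $n\ge 2$, $D_{2n}$ is the orientation of the cycle with $2n$ vertices obtained by choosing two opposite vertices and orienting all edges in the direction from one of them to the other. For an oriented cycle $C$ of even length $\ell$, $\gamma_C=+1$ if $C$ can be obtained from $D_\ell$ by reversing an even number of edges, and $\gamma_C=-1$ otherwise. *)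

(* Defs.v *)
From HB Require Import structures.
From mathcomp Require Import all_boot all_order all_algebra.
From mathcomp Require Import all_classical all_reals all_analysis.

Set Implicit Arguments.
Unset Strict Implicit.
Unset Printing Implicit Defensive.

Import Order.TTheory GRing.Theory Num.Theory.
Import numFieldNormedType.Exports.

Local Open Scope classical_set_scope.
Local Open Scope ring_scope.

Section LebesgueTuple.
Context {R : realType}.
Local Notation leb := (@lebesgue_measure R).
Local Notation RR := (measurableTypeR R).

Definition cons_pair n (p : RR * n.-tuple RR) : n.+1.-tuple RR :=
  [tuple of p.1 :: p.2].

Lemma measurable_cons_pair n :
  measurable_fun [set: RR * n.-tuple RR] (@cons_pair n).
Proof. exact: measurable_cons. Qed.

Section step.
Variables (n : nat) (m : {sigma_finite_measure set (n.-tuple RR) -> \bar R}).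

Definition tuple_product_measure : set (n.+1.-tuple RR) -> \bar R :=
  pushforward (leb \x m)%E (@cons_pair n).

Let pushm : {measure set (n.+1.-tuple RR) -> \bar R} :=
  measure_function_pushforward__canonical__measure_function_Measure
    (leb \x m)%E (@measurable_cons_pair n).

Let tpm0 : tuple_product_measure set0 = 0%E.
Proof. exact: (measure0 pushm). Qed.

Let tpm_ge0 A : (0 <= tuple_product_measure A)%E.
Proof. exact: (measure_ge0 pushm). Qed.

Let tpm_sigma_additive : semi_sigma_additive tuple_product_measure.
Proof. exact: (@measure_semi_sigma_additive _ _ _ pushm). Qed.

HB.instance Definition _ := isMeasure.Build _ _ _
  tuple_product_measure tpm0 tpm_ge0 tpm_sigma_additive.

Lemma tuple_product_measure_sigma_finite :
  sigma_finite setT tuple_product_measure.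
Proof.
have /sigma_finiteP[F [FT ndF mF]] :=
  sigma_finiteT (leb : {sigma_finite_measure set RR -> \bar R}).
have /sigma_finiteP[G [GT ndG mG]] := sigma_finiteT m.
pose g (t : n.+1.-tuple RR) : RR * n.-tuple RR := (thead t, [tuple of behead t]).
have mg : measurable_fun setT g.
  apply/measurable_fun_pairP; split; first exact: measurable_tnth.
  exact: measurable_behead.
have gK p : g (cons_pair p) = p.
  by case: p => x t; rewrite /g/= theadE; congr pair; apply/val_inj.
exists (fun i => g @^-1` (F i `*` G i)).
  rewrite -preimage_bigcup (_ : \bigcup_i _ = setT) ?preimage_setT//.
  apply/seteqP; split => // -[x y] _.
  have [i _ Fix] : (\bigcup_i F i) x by rewrite -FT.
  have [j _ Gjy] : (\bigcup_i G i) y by rewrite -GT.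
  exists (maxn i j) => //; split => /=.
    by move: x Fix; exact/subsetPset/ndF/leq_maxl.
  by move: y Gjy; exact/subsetPset/ndG/leq_maxr.
move=> i; have [mFi Fioo] := mF i; have [mGi Gioo] := mG i; split.
  by rewrite -[X in measurable X]setTI; apply: mg => //; exact: measurableX.
rewrite /tuple_product_measure /pushforward -comp_preimage.
rewrite (_ : g \o @cons_pair n = id) ?preimage_id; last first.
  by apply/funext => p; exact: gK.
by rewrite product_measure1E// lte_mul_pinfty// ge0_fin_numE.
Qed.

HB.instance Definition _ := Measure_isSigmaFinite.Build _ _ _
  tuple_product_measure tuple_product_measure_sigma_finite.

Definition tuple_product :
  {sigma_finite_measure set (n.+1.-tuple RR) -> \bar R} := tuple_product_measure.

End step.

(* Lebesgue measure on R^n: the point mass on the one-point space R^0, and the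
   image of the product measure under R * R^n -> R^n.+1, (x, t) |-> x :: t. *)
Fixpoint lebesgue_tuple n : {sigma_finite_measure set (n.-tuple RR) -> \bar R} :=
  if n is n'.+1 then tuple_product (lebesgue_tuple n')
  else \d_([tuple] : 0.-tuple RR).

Definition unit_cube n : set (n.-tuple RR) :=
  [set x | forall i, (tnth x i : R) \in `[0, 1]].

Definition unit_square : set (RR * RR) := (`[0, 1] : set R) `*` (`[0, 1] : set R).

End LebesgueTuple.

Arguments lebesgue_tuple {R} n.
Arguments unit_cube {R} n _.

Section Kernels.
Context {R : realType}.
Local Notation RR := (measurableTypeR R).

(* A function on [0, 1]^2 is represented by any extension to R^2; all
   conditions and integrals below only involve its values on [0, 1]^2. *)
Definition is_kernel (U : RR * RR -> R) : Prop :=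
  measurable_fun unit_square U /\
  exists M : R, forall z, unit_square z -> `|U z| <= M.

Definition is_tournamenton (W : RR * RR -> R) : Prop :=
  [/\ is_kernel W,
      forall z, unit_square z -> 0 <= W z &
      forall x y, unit_square (x, y) -> W (x, y) + W (y, x) = 1].

Definition kernel_T (z : RR * RR) : R :=
  if (0 <= z.1 :> R) && (z.1 < z.2 :> R) && (z.2 <= 1 :> R) then 2^-1
  else if (0 <= z.2 :> R) && (z.2 < z.1 :> R) && (z.1 <= 1 :> R) then - 2^-1
  else 0.

Definition half_plus (U : RR * RR -> R) (z : RR * RR) : R := 2^-1 + U z.

(* A digraph on the vertex set {0, .., n.-1} is given by its set of arcs. *)
Definition hom_density n (H : {set 'I_n * 'I_n}) (U : RR * RR -> R) : R :=
  \int[lebesgue_tuple n]_(x in unit_cube n)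
    \prod_(e in H) U (tnth x e.1, tnth x e.2).

End Kernels.

Definition quasirandom_forcing (R : realType) n (H : {set 'I_n * 'I_n}) : Prop :=
  forall W : measurableTypeR R * measurableTypeR R -> R,
    is_tournamenton W -> hom_density H W = 2 ^- #|H| ->
    {ae (lebesgue_measure \x lebesgue_measure)%E,
      forall z, unit_square z -> W z = 2^-1}.

Section OrientedCycles.

Definition oriented_graph n (H : {set 'I_n * 'I_n}) : Prop :=
  forall v w, (v, w) \in H -> (w, v) \notin H.

(* For n >= 3, the adjacency relation of the cycle 0, 1, .., n.-1, 0. *)
Definition cycle_graph n : rel 'I_n :=
  fun v w => (w == ordS v) || (v == ordS w).

Definition orientation_of n (G : rel 'I_n) (H : {set 'I_n * 'I_n}) : Prop :=
  oriented_graph H /\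
  forall v w, ((v, w) \in H) || ((w, v) \in H) = G v w.

(* D_n for even n, on the cycle 0, 1, .., n.-1, 0: the n./2 arcs of either path
   from v to the opposite vertex. *)
Definition dicycle n (v : 'I_n) : {set 'I_n * 'I_n} :=
  [set (iter k (@ordS n) v, iter k.+1 (@ordS n) v) | k : 'I_(n./2)] :|:
  [set (iter k (@ord_pred n) v, iter k.+1 (@ord_pred n) v) | k : 'I_(n./2)].

Definition reverse_arcs n (F H : {set 'I_n * 'I_n}) : {set 'I_n * 'I_n} :=
  (H :\: F) :|: [set (e.2, e.1) | e in F].

(* The choice of v ranges over all the copies of D_n in the cycle. *)
Definition cycle_sign n (C : {set 'I_n * 'I_n}) : int :=
  if [exists v : 'I_n, exists F : {set 'I_n * 'I_n},
        [&& F \subset dicycle v, ~~ odd #|F| & C == reverse_arcs F (dicycle v)]]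
  then 1 else -1.

End OrientedCycles.

(* Main.v *)
Require Import Defs.
From HB Require Import structures.
From mathcomp Require Import all_boot all_order all_algebra.
From mathcomp Require Import all_classical all_reals all_analysis.
From mathcomp Require Import measurable_realfun ring lra zify.

(* Let K be the step kernel with values 0, 1/2, -1/2 whose parts are the three
   thirds of [0, 1], arranged cyclically.  Every row of K integrates to 0, so
   t(C, 1/2 + K) = 2^-l + t(C, K), and t(C, K) is the trace of a product of l
   copies of K, with one sign change for each backward arc.  Since K is
   antisymmetric, tr K^l has the sign (-1)^(l/2), and D_l has l/2 backward arcs,
   so t(C, K) has the sign gamma_C.  Hence 1/2 + U_T and 1/2 + K lie on opposite sides of 2^-l, and by
   the intermediate value theorem some convex combination of them has density
   exactly 2^-l.  K is oriented so that it agrees with U_T between the first and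
   the second third; the combination therefore equals 1 there. *)

Set Implicit Arguments.
Unset Strict Implicit.
Unset Printing Implicit Defensive.

Import Order.TTheory GRing.Theory Num.Theory.
Import numFieldNormedType.Exports.

Local Open Scope classical_set_scope.
Local Open Scope ring_scope.

(** * Traces of products of transfer matrices *)

Lemma big_tuple_cons (V : nmodType) (T : finType) (n : nat)
    (F : n.+1.-tuple T -> V) :
  \sum_t F t = \sum_c \sum_(t : n.-tuple T) F [tuple of c :: t].
Proof.
rewrite pair_bigA (reindex (fun p : T * n.-tuple T => [tuple of p.1 :: p.2])) //=.
apply: onW_bij; exists (fun t => (thead t, [tuple of behead t])).
  by case=> c t; rewrite /= theadE; congr pair; apply/val_inj.
by move=> t; rewrite [RHS]tuple_eta; apply/val_inj.
Qed.

Section TransferMatrix.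
Variables (R : comNzRingType) (m : nat).

(** The product sums over walks from [a] to [b]; [t] lists the interior vertices, so step [i] runs
    from entry [i] of [a :: t] to entry [i] of [rcons t b]. All indices are in range, and the
    default [b] is never read. *)
Lemma mx_prodE (n : nat) (M : 'I_n.+1 -> 'M[R]_m.+1) (a b : 'I_m.+1) :
  (\prod_i M i) a b =
  \sum_(t : n.-tuple 'I_m.+1)
    \prod_(i < n.+1) M i (nth b (a :: t) i) (nth b (rcons t b) i).
Proof.
elim: n M a => [|n IH] M a.
  rewrite big_ord1 (bigD1 [tuple]) //= big_ord1 /= big1 ?addr0 // => t.
  by move/eqP; case; exact: tuple0.
rewrite big_ord_recl mxE big_tuple_cons; apply: eq_bigr => c _.
rewrite IH big_distrr /=; apply: eq_bigr => t _.
by rewrite [RHS]big_ord_recl.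
Qed.

(** Only closed walks contribute to a trace. This is the form in which the density of a cycle in a
    step kernel appears. *)
Lemma mxtrace_prodE (n : nat) (M : 'I_n.+1 -> 'M[R]_m.+1) :
  \tr (\prod_i M i) =
  \sum_(t : n.+1.-tuple 'I_m.+1) \prod_i M i (tnth t i) (tnth t (ordS i)).
Proof.
rewrite big_tuple_cons; apply: eq_bigr => a _; rewrite mx_prodE.
apply: eq_bigr => t _; apply: eq_bigr => i _.
rewrite !(tnth_nth a) /=; congr (M i _ _).
(* Only at the last index does [ordS] wrap around, back to the head [a], which is also the last
   entry of [rcons t a]. *)
have [->|ltin] := eqVneq (i : nat) n.
  by rewrite modnn /= nth_rcons size_tuple ltnn eqxx.
have {}ltin : (i < n)%N by have := ltn_ord i; lia.
by rewrite modn_small ?ltnS//= nth_rcons size_tuple ltin.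
Qed.

End TransferMatrix.

(** * Powers of the matrix of the cyclic kernel *)

Section CyclicTriple.
Variable R : numFieldType.

(** Twice the values of K: the skew adjacency matrix of the directed triangle, with addition in
    ['I_3] taken modulo 3. *)
Definition triple : 'M[R]_3 :=
  \matrix_(i, j) ((j == i + 1)%:R - (i == j + 1)%:R).

Definition ones : 'M[R]_3 := const_mx 1.

Lemma ones_sqr : ones * ones = 3 *: ones.
Proof. by apply/matrixP=> i j; rewrite !mxE !big_ord_recl big_ord0 !mxE; ring. Qed.

Lemma ones_triple : ones * triple = 0.
Proof.
apply/matrixP=> i j; rewrite !mxE !big_ord_recl big_ord0 !mxE.
by case: j => -[|[|[|]]] //= ?; rewrite /eq_op /=; ring.
Qed.

Lemma triple_ones : triple * ones = 0.
Proof.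
apply/matrixP=> i j; rewrite !mxE !big_ord_recl big_ord0 !mxE.
by case: i => -[|[|[|]]] //= ?; rewrite /eq_op /=; ring.
Qed.

(** The eigenvalues are thus 0 and the two square roots of -3; this is where the alternating sign of
    the traces comes from. *)
Lemma triple_sqr : triple * triple = ones - 3%:M.
Proof.
apply/matrixP=> i j; rewrite !mxE !big_ord_recl big_ord0 !mxE.
case: i => -[|[|[|]]] //= ?; case: j => -[|[|[|]]] //= ?;
  by rewrite /eq_op /=; ring.
Qed.

Lemma triple_even n : triple ^+ n.+1.*2 = (-3) ^+ n *: (triple * triple).
Proof.
elim: n => [|n IH]; first by rewrite scale1r expr2.
rewrite (doubleS n.+1) 2!exprSr IH -!scalerAl.
(* Of the last factor [ones - 3%:M], the part [ones] is killed by [triple], which leaves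
   multiplication by -3. *)
have -> : triple * triple * triple * triple = -3 *: (triple * triple).
  rewrite -mulrA {2}triple_sqr mulrBr -mulrA triple_ones mulr0 sub0r scaleNr.
  by rewrite -[3%:M]scalemx1 -scalerAr mulr1.
by rewrite scalerA -exprSr.
Qed.

Lemma trace_triple_even n : \tr (triple ^+ n.+1.*2) = 2 * (-3) ^+ n.+1.
Proof.
rewrite triple_even triple_sqr linearZ /= linearB /= mxtrace_scalar.
by rewrite /mxtrace !big_ord_recl big_ord0 !mxE exprS; ring.
Qed.

(** [ones] and [triple] annihilate each other, so every mixed term of the expanded product vanishes
    and only the two pure powers survive. *)
Lemma prod_ones_triple (n : nat) (e : 'I_n.+1 -> R) :
  \prod_i (2^-1 *: (ones + e i *: triple)) =
  2^-1 ^+ n.+1 *: (3 ^+ n *: ones + (\prod_i e i) *: triple ^+ n.+1).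
Proof.
elim: n e => [|n IH] e; first by rewrite !big_ord1 expr0 scale1r.
rewrite big_ord_recl IH -scalerAl -scalerAr scalerA -exprS; congr (_ *: _).
rewrite mulrDl !mulrDr -!scalerAl -!scalerAr ones_sqr triple_ones.
have -> : ones * triple ^+ n.+1 = 0 by rewrite exprS mulrA ones_triple mul0r.
rewrite !scaler0 addr0 add0r.
by rewrite -exprS !scalerA -exprSr [in RHS]big_ord_recl.
Qed.

Lemma trace_prod_ones_triple (n : nat) (e : 'I_n.*2.+2 -> R) :
  \tr (\prod_i (2^-1 *: (ones + e i *: triple))) =
  2^-1 ^+ n.*2.+2 * (3 ^+ n.*2.+2 + 2 * (-3) ^+ n.+1 * \prod_i e i).
Proof.
(* The ascription uses that [n.*2.+2] and [n.+1.*2] are convertible. *)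
have tr_even : \tr (triple ^+ n.*2.+2) = _ := trace_triple_even n.
have tr_ones : \tr ones = 3.
  by rewrite /mxtrace !big_ord_recl big_ord0 !mxE; ring.
rewrite prod_ones_triple linearZ linearD !linearZ /= tr_even tr_ones.
by congr (_ * (_ + _)); rewrite -?exprSr // mulrC.
Qed.

End CyclicTriple.

(** * Signs of oriented cycles *)

Section CycleOrientations.
Variable l : nat.
Hypothesis l_ge3 : (3 <= l)%N.

(* An orientation of the cycle is encoded by the set b of the vertices i whose
   arc to ordS i goes forward. *)
Definition cycle_arc (b : {set 'I_l}) (i : 'I_l) : 'I_l * 'I_l :=
  if i \in b then (i, ordS i) else (ordS i, i).

Definition cycle_arcs (b : {set 'I_l}) : {set 'I_l * 'I_l} :=
  (cycle_arc b @: [set: 'I_l])%SET.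

Lemma iter_ordS k (i : 'I_l) : iter k (@ordS l) i = ((i + k) %% l)%N :> nat.
Proof.
elim: k => [|k IH]; first by rewrite addn0 modn_small.
by rewrite iterS /= IH -addn1 modnDml addn1 addnS.
Qed.

Lemma ordS_neq (i : 'I_l) : ordS i != i.
Proof.
apply/eqP => /(congr1 (@nat_of_ord l)) /=; have := ltn_ord i.
have [iE|] := eqVneq i.+1 l; [move=> h1|move=> h2 h1].
  by rewrite iE modnn; lia.
by rewrite modn_small; lia.
Qed.

(** Length at least 3 keeps the edges filed under [i] and [ordS i] distinct, so that an arc
    determines both its position and its direction. *)
Lemma ordSS_neq (i : 'I_l) : ordS (ordS i) != i.
Proof.
apply/eqP => /(congr1 (@nat_of_ord l)); rewrite (iter_ordS 2 i).
have := ltn_ord i => h; have [h2|h2] := ltnP (i + 2) l.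
  by rewrite modn_small //; lia.
have -> : (i + 2 = (i + 2 - l) + l)%N by lia.
by rewrite modnDr modn_small; lia.
Qed.

Lemma arc_eq (b c : {set 'I_l}) (i j : 'I_l) :
  (cycle_arc b i == cycle_arc c j) = (i == j) && ((i \in b) == (j \in c)).
Proof.
rewrite /cycle_arc; have [<-|ij] /= := eqVneq i j.
  case: ifP => ib; case: ifP => ic; rewrite ?eqxx // xpair_eqE.
    by rewrite andbC (negPf (ordS_neq i)).
  by rewrite (negPf (ordS_neq i)).
case: ifP => ib; case: ifP => jc; rewrite xpair_eqE.
- by rewrite (negPf ij).
- by apply/negP => /andP[/eqP -> h]; have := ordSS_neq j; rewrite ?h // eq_sym h.
- by apply/negP => /andP[/eqP <- h]; have := ordSS_neq i; rewrite ?h // eq_sym h.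
- by rewrite andbC (negPf ij).
Qed.

Lemma arc_inj b : injective (cycle_arc b).
Proof. by move=> i j /eqP; rewrite arc_eq => /andP[/eqP]. Qed.

Lemma mem_arcs b c i : (cycle_arc c i \in cycle_arcs b) = ((i \in c) == (i \in b)).
Proof.
apply/imsetP/idP => [[j _ /eqP]|/eqP h]; first by rewrite arc_eq => /andP[/eqP <-].
by exists i => //; apply/eqP; rewrite arc_eq eqxx h eqxx.
Qed.

Lemma mem_arcsS b i : ((i, ordS i) \in cycle_arcs b) = (i \in b).
Proof.
have -> : (i, ordS i) = cycle_arc [set: 'I_l] i by rewrite /cycle_arc inE.
by rewrite mem_arcs inE; case: (i \in b).
Qed.

Lemma mem_arcs_rev b i : ((ordS i, i) \in cycle_arcs b) = (i \notin b).
Proof.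
have -> : (ordS i, i) = cycle_arc finset.set0 i by rewrite /cycle_arc inE.
by rewrite mem_arcs inE; case: (i \in b).
Qed.

Lemma card_arcs b : #|cycle_arcs b| = l.
Proof. by rewrite card_imset ?cardsT ?card_ord //; exact: arc_inj. Qed.

(** The encoding loses nothing: adjacency gives each edge at least one direction, and orientedness
    at most one. *)
Lemma orientation_arcs (C : {set 'I_l * 'I_l}) :
  orientation_of (@cycle_graph l) C ->
  C = cycle_arcs [set i | (i, ordS i) \in C]%SET.
Proof.
move=> [oriented adjacent]; apply/setP => -[v w].
have [Gvw|nGvw] := boolP (cycle_graph v w); last first.
  move: (nGvw); rewrite -adjacent negb_or => /andP[/negPf -> _].
  apply/esym/negP => /imsetP[i _]; rewrite /cycle_arc; case: ifP => _ [vE wE];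
  by move: nGvw; rewrite /cycle_graph vE wE eqxx ?orbT.
case/orP: (Gvw) => /eqP E; first by rewrite E mem_arcsS inE.
rewrite E mem_arcs_rev inE; apply/idP/idP => [/oriented//|/negPf wC].
by move: (adjacent w (ordS w)); rewrite wC /= => ->; rewrite /cycle_graph eqxx.
Qed.

Lemma prod_arcs (R : comPzRingType) b (G : 'I_l * 'I_l -> R) :
  \prod_(e in cycle_arcs b) G e = \prod_i G (cycle_arc b i).
Proof.
rewrite /cycle_arcs big_imset /=; last by move=> i j _ _; exact: arc_inj.
by apply: eq_bigl => i; rewrite inE.
Qed.

Lemma cardD_arcs b c :
  #|(cycle_arcs b :\: cycle_arcs c)%SET| =
  #|[set i | (i \in b) (+) (i \in c)]%SET|.
Proof.
rewrite -(card_imset _ (@arc_inj b)); congr (#|pred_of_set _|); apply/setP => e.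
rewrite inE; apply/andP/imsetP => [[ec /imsetP[i _ eE]]|[i ibc ->]].
  exists i => //; move: ec; rewrite eE mem_arcs inE.
  by case: (i \in b); case: (i \in c).
by rewrite !mem_arcs eqxx; move: ibc; rewrite inE; case: (i \in b); case: (i \in c).
Qed.

(** The path from [v] along [ordS] consists of forward arcs and the path along [ord_pred] of
    backward ones, so the forward positions are the first half of the cycle counted from [v]. *)
Lemma dicycle_arcs (v : 'I_l) : ~~ odd l ->
  exists2 d : {set 'I_l}, dicycle v = cycle_arcs d & #|d| = l./2.
Proof.
move=> l_even.
pose d := [set iter (k : nat) (@ordS l) v | k : 'I_(l./2)]%SET.
have ldbl : (l = l./2 + l./2)%N by rewrite addnn even_halfK.
have iterP k : (k <= l)%N -> iter k (@ord_pred l) v = iter (l - k) (@ordS l) v.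
  elim: k => [|k IH] kl; first by apply: ord_inj; rewrite [RHS]iter_ordS subn0 modnDr modn_small.
  by rewrite iterS IH 1?ltnW // -subSS subSn // iterS ordSK.
have iter_inj i j : (i < l)%N -> (j < l)%N ->
    iter i (@ordS l) v = iter j (@ordS l) v -> i = j.
  move=> il jl /(congr1 (@nat_of_ord l)); rewrite !iter_ordS => /eqP.
  by rewrite eqn_modDl !modn_small // => /eqP.
exists d; last first.
  rewrite card_imset ?card_ord // => i j /iter_inj h; apply/val_inj/h.
    by have := ltn_ord i; lia.
  by have := ltn_ord j; lia.
have dP k : (k < l)%N -> (iter k (@ordS l) v \in d) = (k < l./2)%N.
  move=> kl; apply/imsetP/idP => [[j _ /iter_inj ->]//|h].
    by have := ltn_ord j; lia.
  by exists (Ordinal h).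
have iterSur i : exists2 k, (k < l)%N & i = iter k (@ordS l) v.
  (* The difference of [i] and [v] modulo [l], with [l] added to avoid truncated subtraction. *)
  exists ((i + (l - v)) %% l)%N; first by rewrite ltn_mod; lia.
  apply: ord_inj; rewrite iter_ordS modnDmr.
  have -> : (v + (i + (l - v)) = i + l)%N by have := ltn_ord v; lia.
  by rewrite modnDr modn_small.
apply/setP => e; rewrite !inE; apply/orP/imsetP.
  case=> /imsetP[k _ ->].
    exists (iter k (@ordS l) v) => //.
    by rewrite /cycle_arc dP ?ltn_ord //; have := ltn_ord k; lia.
  have := ltn_ord k => kl.
  (* A backward arc is filed under its head, hence [k.+1]. *)
  exists (iter k.+1 (@ord_pred l) v) => //.
  have kd : iter k.+1 (@ord_pred l) v \in d = false.
    by rewrite iterP; [rewrite dP; lia | lia].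
  by rewrite /cycle_arc kd [in RHS]iterS ord_predK.
case=> i _ ->; have [k kl ->] := iterSur i; rewrite /cycle_arc dP //.
case: ltnP => kl2; [left|right]; apply/imsetP.
  by exists (Ordinal kl2).
(* Position [k] in the second half lies [l - k] steps back from [v]; it is the head of the backward
   arc with index [l - k.+1]. *)
have h : (l - k.+1 < l./2)%N by lia.
have hS : ((l - k.+1).+1 = l - k)%N by lia.
exists (Ordinal h) => //; rewrite [nat_of_ord _]/= hS !iterP; try lia.
by rewrite !subKn //; lia.
Qed.

Lemma odd_card_addb (b d : {set 'I_l}) :
  odd #|[set i | (i \in b) (+) (i \in d)]%SET| = odd #|b| (+) odd #|d|.
Proof.
have /(congr1 odd) := cardsID d b; rewrite oddD => <-.
have /(congr1 odd) := cardsID b d; rewrite oddD => <-.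
rewrite [in X in _ = _ (+) X]finset.setIC.
have -> : [set i | (i \in b) (+) (i \in d)]%SET = ((b :\: d) :|: (d :\: b))%SET.
  by apply/setP => i; rewrite !inE; case: (i \in b); case: (i \in d).
rewrite cardsU (_ : _ :&: _ = finset.set0)%SET ?cards0 ?subn0 ?oddD.
  by case: (odd _); case: (odd _); case: (odd _).
by apply/setP => i; rewrite !inE; case: (i \in b); case: (i \in d).
Qed.

(** A reversed arc of [d] is never an arc of [d], so an arc of [d] survives the reversal exactly
    when it is outside [F]. Hence the target orientation determines [F]. *)
Lemma reverse_arcsE (b d : {set 'I_l}) (F : {set 'I_l * 'I_l}) :
  F \subset cycle_arcs d ->
  (cycle_arcs b == reverse_arcs F (cycle_arcs d)) =
  (F == cycle_arcs d :\: cycle_arcs b)%SET.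
Proof.
move=> /fintype.subsetP Fd.
have revE c i : ((cycle_arc c i).2, (cycle_arc c i).1) = cycle_arc (~: c) i.
  by rewrite /cycle_arc inE; case: ifP.
have memrev i :
    (cycle_arc (~: d) i \in [set (e.2, e.1) | e in F])%SET = (cycle_arc d i \in F).
  apply/imsetP/idP => [[e eF]|h]; last by exists (cycle_arc d i); rewrite ?revE.
  have /imsetP[j _ eE] := Fd _ eF; rewrite eE revE => /arc_inj ->.
  by rewrite -eE.
have memrev2 i : (cycle_arc d i \in [set (e.2, e.1) | e in F])%SET = false.
  apply/imsetP => -[e eF].
  have /imsetP[j _ ->] := Fd _ eF; rewrite revE => /eqP; rewrite arc_eq inE.
  by case: eqVneq => // -> /=; case: (j \in d).
apply/eqP/eqP => [E|FE].
  apply/setP => e; have [/imsetP[i _ ->]|ed] := boolP (e \in cycle_arcs d); last first.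
    by rewrite inE (negPf ed) andbF; apply/negP => /Fd; rewrite (negPf ed).
  rewrite inE E !inE memrev2 orbF mem_arcs eqxx andbT.
  by case: (cycle_arc d i \in F).
have arcF i : (cycle_arc d i \in F) = (i \in b) (+) (i \in d).
  by rewrite FE inE !mem_arcs eqxx andbT; case: (i \in b); case: (i \in d).
have arcb i : cycle_arc b i =
    if (i \in b) (+) (i \in d) then cycle_arc (~: d) i else cycle_arc d i.
  by rewrite /cycle_arc inE; case: (i \in b); case: (i \in d).
apply/setP => e; rewrite !inE; apply/imsetP/orP => [[i _ ->]|].
  rewrite arcb; case: ifP => ibd; [right | left].
    by rewrite memrev arcF.
  by rewrite arcF ibd mem_arcs eqxx.
case=> [/andP[eF /imsetP[i _ eE]]|/imsetP[f fF ->]].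
  by exists i; rewrite // arcb -arcF -eE (negPf eF).
have /imsetP[i _ fE] := Fd _ fF.
by exists i; rewrite // fE revE arcb -arcF -fE fF.
Qed.

(** For each [v] the only candidate [F] is the set of arcs on which the two orientations disagree.
    Its parity does not depend on [v], because every copy of D_l has l/2 forward arcs. *)
Lemma cycle_signE b : ~~ odd l ->
  cycle_sign (cycle_arcs b) = (-1) ^+ (odd #|b| (+) odd l./2).
Proof.
move=> l_even; rewrite /cycle_sign.
have key (v : 'I_l) (F : {set 'I_l * 'I_l}) : F \subset dicycle v ->
    cycle_arcs b == reverse_arcs F (dicycle v) ->
    odd #|F| = odd #|b| (+) odd l./2.
  have [d -> dl] := dicycle_arcs v l_even => Fd; rewrite reverse_arcsE // => /eqP ->.
  by rewrite cardD_arcs odd_card_addb dl addbC.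
case: ifP => [/existsP[v /existsP[F /and3P[h1 h2 h3]]]|none].
  by rewrite -(key v F) // (negPf h2).
(* When the test fails the parity is odd: otherwise vertex 0 and its disagreement set would pass
   it. *)
suff -> : odd #|b| (+) odd l./2 by [].
have l0 : (0 < l)%N by lia.
pose v := Ordinal l0; have [d dE dl] := dicycle_arcs v l_even.
apply: contraFT none => even_b.
apply/existsP; exists v; apply/existsP; exists (cycle_arcs d :\: cycle_arcs b)%SET.
have Fd : (cycle_arcs d :\: cycle_arcs b \subset cycle_arcs d)%SET by exact: finset.subsetDl.
rewrite dE Fd reverse_arcsE // eqxx andbT /=.
by rewrite cardD_arcs odd_card_addb dl addbC.
Qed.

End CycleOrientations.

(** * Lebesgue measure on the cube and step kernels *)

Section LebesgueTupleTheory.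
Context {R : realType}.
Local Notation leb := (@lebesgue_measure R).
Local Notation RR := (measurableTypeR R).

Definition tuple_box n (A : 'I_n -> set RR) : set (n.-tuple RR) :=
  [set x | forall i, A i (tnth x i)].

Lemma measurable_tuple_box n (A : 'I_n -> set RR) :
  (forall i, measurable (A i)) -> measurable (tuple_box A).
Proof.
move=> mA.
have -> : tuple_box A = \bigcap_(i in [set: 'I_n]) ((@tnth n RR)^~ i @^-1` A i).
  by apply/seteqP; split => x /= h i; [move=> _; exact: h | exact: h].
apply: fin_bigcap_measurable => // i _; rewrite -[X in measurable X]setTI.
exact: measurable_tnth.
Qed.

Lemma lebesgue_tuple_box n (A : 'I_n -> set RR) (a : 'I_n -> R) :
  (forall i, measurable (A i)) -> (forall i, leb (A i) = (a i)%:E) ->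
  lebesgue_tuple n (tuple_box A) = (\prod_i a i)%:E.
Proof.
elim: n A a => [|n IH] A a mA lA.
  rewrite big_ord0 (_ : tuple_box A = setT) /= ?diracT //.
  by apply/seteqP; split => // x _ [].
rewrite big_ord_recl EFinM -lA -(IH _ _ (fun i => mA (lift ord0 i)) (fun i => lA (lift ord0 i))).
rewrite -product_measure1E //; last by apply: measurable_tuple_box => i; exact: mA.
rewrite /= /tuple_product_measure /pushforward; congr (_ _).
apply/seteqP; split => -[x t] /=.
  move=> h; split; first by have := h ord0.
  by move=> i; have := h (lift ord0 i); rewrite tnthS.
move=> [Ax Bt] i; case: (unliftP ord0 i) => [j ->|-> //].
by rewrite tnthS; exact: Bt.
Qed.

Lemma unit_cubeE n : @unit_cube R n = tuple_box (fun=> (`[0, 1]%classic : set R)).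
Proof. by apply/seteqP; split => x /= h i; have := h i; rewrite /= ?in_itv. Qed.

Lemma measurable_unit_cube n : measurable (@unit_cube R n).
Proof. by rewrite unit_cubeE; exact: measurable_tuple_box. Qed.

Lemma lebesgue_unit_cube n : lebesgue_tuple n (@unit_cube R n) = 1%E.
Proof.
rewrite unit_cubeE (@lebesgue_tuple_box _ _ (fun=> 1)) ?big1 // => i.
by rewrite lebesgue_measure_itv /= lte_fin ltr01 oppr0 adde0.
Qed.

Lemma unit_cube_lty n : (lebesgue_tuple n (@unit_cube R n) < +oo)%E.
Proof. by rewrite lebesgue_unit_cube ltry. Qed.

End LebesgueTupleTheory.

(** * Step functions on the thirds of the unit interval *)

Section StepKernel.
Context {R : realType}.
Local Notation leb := (@lebesgue_measure R).
Local Notation RR := (measurableTypeR R).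

(** Total on the line: points outside [0, 1] fall into the first or last part, so step kernels are
    defined and bounded everywhere. *)
Definition third (x : RR) : 'I_3 :=
  if (x : R) < 3^-1 then 0 else if (x : R) < 2 / 3 then 1 else 2.

Definition third_piece (j : 'I_3) : set RR := [set x | (`[0, 1]%classic : set R) x /\ third x = j].

Lemma third_pieceE (j : 'I_3) :
  third_piece j =
  if j == 0 then [set` `[0, 3^-1[%R] else
  if j == 1 then [set` `[3^-1, 2 / 3[%R] else [set` `[2 / 3, 1]%R].
Proof.
apply/seteqP; split => x /=; rewrite /third_piece /= /third in_itv /=.
  case=> /andP[x0 x1] <-; case: ltP => h1; first by rewrite /= in_itv /= x0.
  by case: ltP => h2 /=; rewrite in_itv /= ?h1 ?h2.
case: eqVneq => [->|j0]; first by rewrite /= in_itv /= => /andP[h0 h1]; rewrite h1; split=> //; lra.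
case: eqVneq => [->|j1]; rewrite /= in_itv /= => /andP[h0 h1].
  by rewrite ltNge h0 /= h1; split=> //; lra.
rewrite !ltNge h0 (_ : 3^-1 <= x) /=; last lra.
split; first by lra.
by case: j j0 j1 => -[|[|[|]]] // ? _ _; exact: val_inj.
Qed.

Lemma measurable_third_piece j : measurable (third_piece j).
Proof. by rewrite third_pieceE; case: ifP => // _; case: ifP. Qed.

Lemma lebesgue_third_piece j : leb (third_piece j) = (3^-1)%:E.
Proof.
rewrite third_pieceE; case: ifP => _; [|case: ifP => _];
 rewrite lebesgue_measure_itv /= lte_fin.
- by rewrite invr_gt0 ltr0n oppr0 adde0.
- by rewrite ifT; [rewrite -EFinB; congr EFin; lra | lra].
- by rewrite ifT; [rewrite -EFinB; congr EFin; lra | lra].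
Qed.

(** The integrand is a combination of indicators of boxes, one for each of the 3^n colourings, and
    each box has volume 3^-n. *)
Lemma Rintegral_step n (F : n.-tuple 'I_3 -> R) :
  \int[lebesgue_tuple n]_(x in unit_cube n) F (map_tuple third x) =
  3^-1 ^+ n * \sum_t F t.
Proof.
pose box (t : n.-tuple 'I_3) := tuple_box (fun i => third_piece (tnth t i)).
have mbox t : measurable (box t).
  by apply: measurable_tuple_box => i; exact: measurable_third_piece.
have mcube := @measurable_unit_cube R n.
have boxE t : (\int[lebesgue_tuple n]_(x in unit_cube n) (\1_(box t) x)%:E)%E
    = (3^-1 ^+ n)%:E.
  rewrite integral_indic // (_ : _ `&` _ = box t).
    transitivity (lebesgue_tuple n (box t)) => //.
    rewrite (@lebesgue_tuple_box _ _ _ (fun=> 3^-1)) ?prodr_const ?card_ord //.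
      by move=> i; exact: measurable_third_piece.
    by move=> i; exact: lebesgue_third_piece.
  apply/seteqP; split => x; first by case.
  by move=> xt; split => // i; have [] := xt i.
have intbox t : (lebesgue_tuple n).-integrable (unit_cube n) (EFin \o \1_(box t)).
  apply: measurable_bounded_integrable => //.
  - exact: unit_cube_lty.
  - exists 1; split => // M M1 x _ /=.
    by rewrite indicE; case: (_ \in _); rewrite ?normr1 ?normr0; lra.
rewrite /Rintegral (eq_integral (fun x => \sum_t ((F t)%:E * (\1_(box t) x)%:E)%E)).
  rewrite integral_sum //.
    rewrite (eq_bigr (fun t => (3^-1 ^+ n * F t)%:E)).
      by rewrite sumEFin /= mulr_sumr.
    move=> t _; rewrite integralZl //; last exact: intbox.
    by rewrite muleC EFinM; congr (_ * _)%E; exact: boxE.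
  move=> t; apply: integrableZl; [exact: mcube | exact: intbox].
move=> x; rewrite inE => xc; rewrite sumEFin; congr EFin.
(* A point of the cube lies in exactly one box, that of its own colouring. *)
rewrite (bigD1 (map_tuple third x)) //= big1.
  rewrite indicE mem_set ?mulr1 ?addr0 // => i /=; split; first by have := xc i; rewrite /= in_itv.
  by rewrite tnth_map.
move=> t tx; rewrite indicE memNset ?mulr0 // => xt; move/eqP: tx; apply.
by apply/eq_from_tnth => i; rewrite tnth_map; have [_ ->] := xt i.
Qed.

Lemma measurable_step (F : 'I_3 -> 'I_3 -> R) :
  measurable_fun [set: RR * RR] (fun z => F (third z.1) (third z.2)).
Proof.
have -> : (fun z : RR * RR => F (third z.1) (third z.2)) = (fun z =>
   if (z.1 : R) < 3^-1 then
     if (z.2 : R) < 3^-1 then F 0 0 else if (z.2 : R) < 2 / 3 then F 0 1 else F 0 2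
   else if (z.1 : R) < 2 / 3 then
     if (z.2 : R) < 3^-1 then F 1 0 else if (z.2 : R) < 2 / 3 then F 1 1 else F 1 2
   else
     if (z.2 : R) < 3^-1 then F 2 0 else if (z.2 : R) < 2 / 3 then F 2 1 else F 2 2).
  apply/funext => z; rewrite /third.
  by case: ifP => _; [|case: ifP => _]; (case: ifP => _; [|case: ifP => _]).
do !(apply: measurable_fun_ifT => //); by apply: measurable_fun_ltr.
Qed.

Lemma measurable_kernel_T : measurable_fun [set: RR * RR] (@kernel_T R).
Proof.
have mcond (f g : RR * RR -> R) : measurable_fun setT f -> measurable_fun setT g ->
    measurable_fun setT (fun z => (0 <= f z) && (f z < g z) && (g z <= 1)).
  move=> mf mg; apply: measurable_and; last first.
    exact: measurable_fun_ler.
  apply: measurable_and; first exact: measurable_fun_ler.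
  exact: measurable_fun_ltr.
apply: measurable_fun_ifT; [exact: mcond | exact: measurable_cst |].
by apply: measurable_fun_ifT; [exact: mcond | exact: measurable_cst |].
Qed.

End StepKernel.

(** * From the transitive tournamenton to the cyclic one *)

Lemma norm_prodB_le (R : numDomainType) (I : Type) (r : seq I) (P : pred I)
    (a b : I -> R) :
  (forall i, `|a i| <= 1) -> (forall i, `|b i| <= 1) ->
  `|\prod_(i <- r | P i) a i - \prod_(i <- r | P i) b i|
    <= \sum_(i <- r | P i) `|a i - b i|.
Proof.
move=> a1 b1.
(* The bound on the product of the [b i] joins the induction because it multiplies the error of each
   new factor. *)
suff [] : `|\prod_(i <- r | P i) b i| <= 1 /\
  `|\prod_(i <- r | P i) a i - \prod_(i <- r | P i) b i|
    <= \sum_(i <- r | P i) `|a i - b i| by [].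
elim/big_rec3: _ => [|i x y z _ [z1 yzx]]; first by rewrite subrr normr0 normr1.
split; first by rewrite normrM mulr_ile1.
have -> : a i * y - b i * z = (a i - b i) * z + a i * (y - z) by ring.
rewrite (le_trans (ler_normD _ _)) // !normrM lerD // ?ler_piMr //.
exact: le_trans (ler_piMl _ _) yzx.
Qed.

Section Densities.
Context {R : realType}.
Local Notation RR := (measurableTypeR R).
Local Notation cube n := (@unit_cube R n).

Section Bounded.
Variables (n : nat) (H : {set 'I_n * 'I_n}).

Lemma integrable_hom (U : RR * RR -> R) :
  measurable_fun setT U -> (forall z, `|U z| <= 1) ->
  (lebesgue_tuple n).-integrable (cube n)
    (EFin \o (fun x => \prod_(e in H) U (tnth x e.1, tnth x e.2))).
Proof.
move=> mU U1; apply: measurable_bounded_integrable.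
- exact: measurable_unit_cube.
- exact: unit_cube_lty.
- apply: measurable_funTS; under eq_fun do rewrite -big_enum.
  apply: measurable_prod => e _.
  apply: (measurableT_comp mU); apply: measurable_fun_pair; exact: measurable_tnth.
- exists 1; split => // M M1 x _ /=; apply: le_trans (ltW M1).
  by rewrite normr_prod; apply: prodr_ile1 => e _; rewrite normr_ge0 U1.
Qed.

(* Replacing the factors of the product one at a time costs d for each arc. *)
Lemma hom_density_dist (U V : RR * RR -> R) (d : R) :
  measurable_fun setT U -> (forall z, `|U z| <= 1) ->
  measurable_fun setT V -> (forall z, `|V z| <= 1) ->
  (forall z, `|U z - V z| <= d) ->
  `|hom_density H U - hom_density H V| <= d *+ #|H|.
Proof.
move=> mU U1 mV V1 UVd; rewrite /hom_density.
have mcube := @measurable_unit_cube R n.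
have iU := integrable_hom mU U1; have iV := integrable_hom mV V1.
rewrite -RintegralB //.
apply: (le_trans (le_normr_Rintegral _ _)) => //.
  by have := integrableB mcube iU iV.
apply: (@le_trans _ _ (\int[lebesgue_tuple n]_(x in cube n) (d *+ #|H|))).
  apply: le_Rintegral => //.
  - by have := integrable_norm (integrableB mcube iU iV).
  - apply: measurable_bounded_integrable => //; first exact: unit_cube_lty.
    by exists `|d *+ #|H| |; split => // M M1 x _ /=; exact: ltW.
  move=> x _; apply: (le_trans (norm_prodB_le _ _ _ _)) => //.
  by rewrite -sumr_const; apply: ler_sum => e _; exact: UVd.
by rewrite Rintegral_cst // [X in fine X](lebesgue_unit_cube n) mulr1.
Qed.

End Bounded.

(** * The kernel K and the segment from U_T to it *)

Definition step_kernel (z : RR * RR) : R :=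
  2^-1 * triple R (third z.1) (third z.2).

Definition mix_kernel (s : R) (z : RR * RR) : R :=
  (1 - s) * kernel_T z + s * step_kernel z.

Lemma kernel_T_antisym x y : kernel_T (y, x) = - kernel_T (x, y) :> R.
Proof.
rewrite /kernel_T /=; case: ifP => [/andP[/andP[h1 h2] h3]|h].
  by rewrite (lt_gtF h2) andbF /= opprK.
by case: ifP => _; rewrite ?opprK ?oppr0.
Qed.

Lemma kernel_T_bound z : `|kernel_T z| <= 2^-1 :> R.
Proof.
by rewrite /kernel_T; case: ifP => _; [|case: ifP => _];
  rewrite ?normrN ?normr0 ?gtr0_norm ?invr_ge0 ?invr_gt0.
Qed.

Lemma step_kernel_antisym x y : step_kernel (y, x) = - step_kernel (x, y).
Proof. by rewrite /step_kernel !mxE -mulrN opprB. Qed.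

Lemma step_kernel_bound z : `|step_kernel z| <= 2^-1.
Proof.
rewrite /step_kernel normrM gtr0_norm ?invr_gt0 // ler_piMr ?invr_ge0 // mxE.
by case: (_ == _); case: (_ == _); rewrite ?subrr ?subr0 ?sub0r ?normrN ?normr1 ?normr0.
Qed.

Lemma mix_kernel_antisym s x y : mix_kernel s (y, x) = - mix_kernel s (x, y).
Proof. by rewrite /mix_kernel kernel_T_antisym step_kernel_antisym; ring. Qed.

Lemma mix_kernel_bound s z : 0 <= s <= 1 -> `|mix_kernel s z| <= 2^-1.
Proof.
move=> /andP[s0 s1]; have := kernel_T_bound z; have := step_kernel_bound z.
rewrite /mix_kernel !ler_norml => /andP[h1 h2] /andP[h3 h4]; apply/andP; split; nra.
Qed.

Lemma measurable_mix_kernel s : measurable_fun setT (half_plus (mix_kernel s)).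
Proof.
apply: measurable_funD => //; apply: measurable_funD; apply: measurable_funM => //.
  exact: measurable_kernel_T.
exact: (@measurable_step R (fun i j => 2^-1 * triple R i j)).
Qed.

Lemma half_plus_mix_bound s z : 0 <= s <= 1 -> 0 <= half_plus (mix_kernel s) z <= 1.
Proof.
by move=> /(mix_kernel_bound z); rewrite /half_plus ler_norml => /andP[h1 h2]; lra.
Qed.

Lemma half_plus_mix_norm s z : 0 <= s <= 1 -> `|half_plus (mix_kernel s) z| <= 1.
Proof. by move=> /(half_plus_mix_bound z) /andP[h1 h2]; rewrite ger0_norm. Qed.

Lemma tournamenton_mix s : 0 <= s <= 1 -> is_tournamenton (half_plus (mix_kernel s)).
Proof.
move=> s01; split.
- split; first by apply: measurable_funTS; exact: measurable_mix_kernel.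
  by exists 1 => z _; exact: half_plus_mix_norm.
- by move=> z _; have /andP[] := half_plus_mix_bound z s01.
- by move=> x y _; rewrite /half_plus mix_kernel_antisym; lra.
Qed.

Lemma mix_kernel_half s x y : third x = 0 -> third y = 1 ->
  unit_square (x, y) -> mix_kernel s (x, y) = 2^-1.
Proof.
move=> x0 y1; rewrite /unit_square /= !in_itv /= => -[/andP[h1 h2] /andP[h3 h4]].
have xy : (x : R) < y.
  have hx : (x : R) < 3^-1 by move: x0; rewrite /third; case: ifP => // _; case: ifP.
  have hy : 3^-1 <= (y : R) by move: y1; rewrite /third; case: ltP.
  exact: lt_le_trans hx hy.
rewrite /mix_kernel /kernel_T /step_kernel /= h1 xy h4 /= x0 y1 mxE /=.
rewrite /eq_op /=; lra.
Qed.

Lemma mix_not_half s :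
  ~ {ae (lebesgue_measure \x lebesgue_measure)%E,
      forall z, unit_square z -> half_plus (mix_kernel s) z = 2^-1}.
Proof.
move=> [N [mN N0 subN]].
(* On this rectangle of measure 1/9 the tournamenton is 1 for every [s], so a set containing all
   exceptions cannot be null. *)
pose Q := @third_piece R 0 `*` @third_piece R 1.
have QN : Q `<=` N.
  move=> [x y] [[/= hx x0] [/= hy y1]]; apply: subN => /= h.
  have sq : unit_square (x, y) by [].
  have := h sq; rewrite /half_plus mix_kernel_half //; lra.
have mQ : measurable Q by apply: measurableX; exact: measurable_third_piece.
have := le_measure (lebesgue_measure \x lebesgue_measure)%E (mem_set mQ) (mem_set mN) QN.
rewrite [X in (_ <= X)%E]N0 [X in (X <= _)%E]product_measure1E;
  try exact: measurable_third_piece.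
rewrite [X in (X * _ <= _)%E]lebesgue_third_piece.
rewrite [X in (_ * X <= _)%E]lebesgue_third_piece -EFinM lee_fin; lra.
Qed.

(** The density is Lipschitz in [s] with constant [#|H|]: U_T and K differ by at most 1, so the
    kernels at [s] and [t] differ by at most |s - t|. *)
Lemma hom_density_mix_continuous n (H : {set 'I_n * 'I_n}) :
  {within `[0, 1], continuous (fun s => hom_density H (half_plus (mix_kernel s)))}.
Proof.
apply/subspace_continuousP => s /=; rewrite in_itv /= => s01.
(* The successor in the denominator covers a graph without arcs. *)
apply/cvgrPdist_le => e e0; have d0 : 0 < e / #|H|.+1%:R by rewrite divr_gt0.
near=> t.
have t01 : 0 <= t <= 1.
  have : `[0, 1]%classic t by near: t; exact: withinT.
  by rewrite /= in_itv.
have st : `|s - t| <= e / #|H|.+1%:R.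
  by near: t; apply: filterS (nbhsx_ballx s _ d0) => u /ltW.
apply: le_trans (@hom_density_dist n H _ _ `|s - t| (measurable_mix_kernel s)
  _ (measurable_mix_kernel t) _ _) _.
- by move=> z; exact: half_plus_mix_norm.
- by move=> z; exact: half_plus_mix_norm.
- move=> z; rewrite /half_plus /mix_kernel.
  rewrite (_ : _ - _ = (s - t) * (step_kernel z - kernel_T z)); last by ring.
  rewrite normrM ler_piMr //; have := kernel_T_bound z; have := step_kernel_bound z.
  rewrite !ler_norml => /andP[h1 h2] /andP[h3 h4]; lra.
rewrite -mulr_natr; apply: (@le_trans _ _ (e / #|H|.+1%:R * #|H|%:R)).
  by rewrite ler_wpM2r.
by rewrite mulrAC ler_pdivrMr // ler_wpM2l ?ltW // ltr_nat.
Unshelve. all: by end_near.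
Qed.

(** By antisymmetry a backward arc has the transfer matrix of a forward one with [triple] negated,
    so the density is a trace of the kind computed above. Here [n.+1] is half the length, and the
    volume 3^-l of a box cancels the main term 3^l. *)
Lemma hom_density_step n (b : {set 'I_n.*2.+2}) : (0 < n)%N ->
  hom_density (cycle_arcs b) (half_plus step_kernel) =
  2 ^- n.*2.+2 * (1 + 2 * (-1) ^+ (#|b| + n.+1) / 3 ^+ n.+1).
Proof.
move=> n_gt0; have l_ge3 : (2 < n.*2.+2)%N by lia.
pose e (i : 'I_n.*2.+2) : R := if i \in b then 1 else -1.
pose M i := 2^-1 *: (ones R + e i *: triple R).
(* The sign counts the backward arcs; as the length is even, their number has the parity of
   [#|b|]. *)
have prod_e : \prod_i e i = (-1) ^+ #|b|.
  rewrite (bigID (mem b)) /= big1 ?mul1r => [|i ib]; last by rewrite /e ib.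
  rewrite (eq_bigr (fun=> -1)) => [|i /negPf ib]; last by rewrite /e ib.
  rewrite prodr_const -signr_odd -[in RHS]signr_odd; congr (_ ^+ nat_of_bool _).
  have := congr1 odd (cardC (mem b)).
  by rewrite card_ord oddD /= odd_double; case: (odd _); case: (odd _).
rewrite /hom_density.
pose F (t : n.*2.+2.-tuple 'I_3) := \prod_i M i (tnth t i) (tnth t (ordS i)).
rewrite (@eq_Rintegral _ _ _ _ _ (fun x => F (map_tuple third x))).
  rewrite Rintegral_step -mxtrace_prodE trace_prod_ones_triple prod_e.
  have h3 : 3 ^+ n.+1 != 0 :> R by rewrite expf_eq0 pnatr_eq0.
  have -> : 3 ^+ n.*2.+2 = 3 ^+ n.+1 * 3 ^+ n.+1 :> R.
    by rewrite -exprD addnn doubleS.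
  have -> : 3^-1 ^+ n.*2.+2 = (3 ^+ n.+1 * 3 ^+ n.+1)^-1 :> R.
    by rewrite -exprD addnn doubleS exprVn.
  by rewrite -[2 ^- _]exprVn [(-3) ^+ _]exprNn exprD; field.
move=> x _; rewrite prod_arcs // /F; apply: eq_bigr => i _; rewrite !tnth_map.
by rewrite /cycle_arc /half_plus /step_kernel /M /e; case: ifP => _ /=; rewrite !mxE; ring.
Qed.

End Densities.

(** * The intermediate value argument *)

Theorem theorem16 (R : realType) (l : nat) (l_ge3 : (3 <= l)%N)
    (l_even : ~~ odd l) (C : {set 'I_l * 'I_l})
    (C_cycle : orientation_of (@cycle_graph l) C) :
  (hom_density C (half_plus (@kernel_T R)) <= 2 ^- l -> cycle_sign C = 1 ->
     ~ quasirandom_forcing R C) /\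
  (hom_density C (half_plus (@kernel_T R)) >= 2 ^- l -> cycle_sign C = -1 ->
     ~ quasirandom_forcing R C).
Proof.
have CE := orientation_arcs l_ge3 C_cycle.
move: CE; set b := finset _ => CE.
pose f s := hom_density C (half_plus (@mix_kernel R s)).
have cardC : #|C| = l by rewrite CE card_arcs.
have f0 : f 0 = hom_density C (half_plus (@kernel_T R)).
  rewrite /f; congr (hom_density _ (half_plus _)); apply/funext => z.
  by rewrite /mix_kernel; ring.
have f1 : f 1 = 2 ^- l * (1 + 2 * (-1) ^+ (#|b| + l./2) / 3 ^+ l./2).
  have [n lE] : exists n, l = n.*2.+2 by exists l./2.-1; lia.
  rewrite /f CE; have -> : mix_kernel 1 = @step_kernel R.
    by apply/funext => z; rewrite /mix_kernel; ring.
  clear -lE l_ge3; subst l; rewrite hom_density_step; last by lia.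
  by rewrite /= doubleK.
have not_forcing : Num.min (f 0) (f 1) <= 2 ^- l <= Num.max (f 0) (f 1) ->
    ~ quasirandom_forcing R C.
  move=> /(IVT ler01 (@hom_density_mix_continuous R _ C)) [s s01 fs] forcing.
  apply: (@mix_not_half R s); apply: forcing; last by rewrite cardC.
  by apply: tournamenton_mix; move: s01; rewrite in_itv.
(* The exponent is the one in [f1], so the sign of the cycle tells on which side of 2^-l the
   endpoint [f 1] lies. *)
have sgn : cycle_sign C = (-1) ^+ (#|b| + l./2).
  by rewrite CE cycle_signE // -oddD signr_odd.
have eps_ge0 : 0 <= 2 / 3 ^+ l./2 :> R by rewrite divr_ge0 // exprn_ge0.
split => f0le; rewrite sgn -signr_odd => sgnC; apply: not_forcing;
  rewrite f0 f1 -signr_odd.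
  (* Positive sign: [f 0] is at most 2^-l and [f 1] at least 2^-l. The negative case below is the
     mirror image. *)
  have -> : odd (#|b| + l./2) = false by case: (odd _) sgnC.
  rewrite ge_min le_max f0le /= ler_peMr ?orbT // ?invr_ge0 ?exprn_ge0 //.
  by rewrite mulr1; lra.
have -> : odd (#|b| + l./2) = true by case: (odd _) sgnC.
rewrite ge_min le_max f0le /= ler_piMr ?orbT // ?invr_ge0 ?exprn_ge0 //.
by rewrite expr1 mulrN1 mulNr; lra.
Qed.
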